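(* Let $\Bbbk$ be an algebraically closed field of characteristic $0$. Consider a skew group ring $T = A \,\#\, G$, where $A$ is a commutative noetherian $\Bbbk$-algebra which is a domain and $G$ is a finite group. Then $T$ is prime noetherian. Moreover, $T$ is Azumaya if and only if $G$ acts freely on $A$, and in this case, $\operatorname{rank} T = |G|^2$.
   Context: For a group $G$ acting on a ring $A$, the skew group ring $A \,\#\, G$ is the free left $A$-module with the elements of $G$ as a basis and multiplication extended linearly from $(ag)(bh) = a\,(g\cdot b)\, gh$ for $a,b\in A$, $g,h\in G$. Noetherian means left and right noetherian. The group $G$ acts freely on $A$ if the stabiliser in $G$ of every maximal ideal of $A$ is trivial. A ring $T$ with centre $Z$ is Azumaya (over its centre) if $T$ is a finitely generated projective $Z$-module and the map $T\otimes_Z T^{\mathrm{op}} \to \operatorname{End}_Z(T)$, $a\otimes b \mapsto (r\mapsto arb)$, is an isomorphism. If $T$ is prime Azumaya, then $\dim_{Z/\mathfrak{m}}(T/\mathfrak{m}T)$ is the same for all maximal ideals $\mathfrak{m}$ of $Z$; this value is the rank of $T$ (over its centre).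
   Formalization: G is assumed to act faithfully and k-linearly on A (for a non-faithful action T is not prime), and ''T Azumaya implies G acts freely'' is stated only when every residue field A/m equals k; it fails for A = k(x) with x ↦ −x. *)

(* Defs.v *)
From HB Require Import structures.
From mathcomp Require Import all_boot all_fingroup all_algebra.
From mathcomp Require Import boolp classical_sets.

Set Implicit Arguments.
Unset Strict Implicit.
Unset Printing Implicit Defensive.

Import GRing.Theory.

Local Open Scope classical_set_scope.
Local Open Scope ring_scope.

(* Ideals of a (not necessarily commutative) ring. *)
Section Ideals.
Variable T : nzRingType.
Implicit Types I J : set T.

Definition left_ideal I : Prop :=
  [/\ I 0, forall x y, I x -> I y -> I (x + y) & forall r x, I x -> I (r * x)].

Definition right_ideal I : Prop :=
  [/\ I 0, forall x y, I x -> I y -> I (x + y) & forall r x, I x -> I (x * r)].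

Definition two_sided_ideal I : Prop := left_ideal I /\ right_ideal I.

Definition maximal_ideal I : Prop :=
  [/\ two_sided_ideal I, ~ I 1
    & forall J, two_sided_ideal J -> ~ J 1 -> I `<=` J -> J = I].

Definition acc (P : set T -> Prop) : Prop :=
  forall I : nat -> set T,
    (forall n, P (I n)) -> (forall n, I n `<=` I n.+1) ->
    exists N, forall n, (N <= n)%N -> I n = I N.

Definition noetherian : Prop := acc left_ideal /\ acc right_ideal.

(* "I `<=` [set 0]" says that the ideal I is zero. *)
Definition prime_ring : Prop :=
  forall I J, two_sided_ideal I -> two_sided_ideal J ->
    (forall x y, I x -> J y -> x * y = 0) ->
    I `<=` [set 0] \/ J `<=` [set 0].

End Ideals.

Arguments noetherian : clear implicits.
Arguments prime_ring : clear implicits.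

(* (Left) actions of a finite group by ring automorphisms. Each map is only
   required to be a ring endomorphism: the two laws make it bijective. *)
Record ring_action (G : finGroupType) (A : nzRingType) := RingAction {
  ract :> G -> {rmorphism A -> A};
  ract1 : forall a, ract 1%g a = a;
  ractM : forall g h a, ract (g * h)%g a = ract g (ract h a)
}.

Section Actions.
Variables (G : finGroupType) (A : nzRingType) (act : ring_action G A).

Definition faithful_action : Prop :=
  forall g, (forall a, act g a = a) -> g = 1%g.

Definition acts_freely : Prop :=
  forall m : set A, maximal_ideal m -> forall g, act g @` m = m -> g = 1%g.

End Actions.

(* Every residue field of the k-algebra A is k. If k is algebraically closed,
   this holds when A is a finitely generated commutative k-algebra, by the
   Nullstellensatz. *)
Definition rational_residue_fields (k : fieldType) (A : comAlgType k) : Prop :=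
  forall m : set A, maximal_ideal m ->
  forall a : A, exists c : k, m (a - c%:A).

(* The skew group ring A # G; x : {ffun G -> A} stands for
   \sum_g (x g) g. *)
Definition skew_ring (G : finGroupType) (A : nzRingType)
  (act : ring_action G A) : Type := {ffun G -> A}.

Section SkewRing.
Variables (G : finGroupType) (A : nzRingType) (act : ring_action G A).
Local Notation T := (skew_ring act).

HB.instance Definition _ := GRing.Zmodule.on T.

(* The element a g. *)
Definition skew_mono (a : A) (g : G) : T :=
  [ffun h => if h == g then a else 0].

Definition skew_one : T := skew_mono 1 1%g.

Definition skew_mul (x y : T) : T :=
  [ffun k => \sum_g x g * act g (y (g^-1 * k)%g)].

Lemma skew_mulA : associative skew_mul.
Proof.
move=> x y z; apply/ffunP => k; rewrite !ffunE.
under eq_bigr => g _ do rewrite ffunE rmorph_sum mulr_sumr /=.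
under [RHS]eq_bigr => g _ do rewrite ffunE mulr_suml /=.
rewrite [RHS]exchange_big /=; apply: eq_bigr => g _.
rewrite [RHS](reindex_inj (mulgI g)) /=; apply: eq_bigr => h _.
by rewrite mulKg rmorphM ractM mulrA invMg mulgA.
Qed.

Lemma skew_mul1 : left_id skew_one skew_mul.
Proof.
move=> x; apply/ffunP => k; rewrite !ffunE (bigD1 1%g) //= big1 => [|g ng].
  by rewrite ffunE eqxx mul1r ract1 invg1 mul1g addr0.
by rewrite ffunE (negPf ng) mul0r.
Qed.

Lemma skew_mulr1 : right_id skew_one skew_mul.
Proof.
move=> x; apply/ffunP => k; rewrite !ffunE (bigD1 k) //= big1 => [|g ng].
  by rewrite ffunE mulVg eqxx rmorph1 mulr1 addr0.
by rewrite ffunE -eq_mulVg1 (negPf ng) rmorph0 mulr0.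
Qed.

Lemma skew_mulDl : left_distributive skew_mul +%R.
Proof.
move=> x y z; apply/ffunP => k; rewrite !ffunE -big_split /=.
by apply: eq_bigr => g _; rewrite ffunE mulrDl.
Qed.

Lemma skew_mulDr : right_distributive skew_mul +%R.
Proof.
move=> x y z; apply/ffunP => k; rewrite !ffunE -big_split /=.
by apply: eq_bigr => g _; rewrite ffunE rmorphD mulrDr.
Qed.

Lemma skew_one_neq0 : skew_one != 0.
Proof.
apply/eqP => /ffunP/(_ 1%g); rewrite !ffunE eqxx => /eqP.
by rewrite oner_eq0.
Qed.

HB.instance Definition _ := GRing.Zmodule_isNzRing.Build T
  skew_mulA skew_mul1 skew_mulr1 skew_mulDl skew_mulDr skew_one_neq0.

Lemma skew_monoM (a b : A) (g h : G) :
  skew_mono a g * skew_mono b h = skew_mono (a * act g b) (g * h)%g.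
Proof.
apply/ffunP => k; rewrite !ffunE (bigD1 g) //= big1 => [|g' ng].
  rewrite !ffunE eqxx addr0 -(inj_eq (mulgI g)) mulKVg.
  by case: eqP => // _; rewrite rmorph0 mulr0.
by rewrite ffunE (negPf ng) mul0r.
Qed.

Lemma skew_sum (x : T) : x = \sum_g skew_mono (x g) g.
Proof.
apply/ffunP => k; rewrite sum_ffunE (bigD1 k) //= big1 => [|g ng].
  by rewrite ffunE eqxx addr0.
by rewrite ffunE eq_sym (negPf ng).
Qed.

End SkewRing.

(* The centre of a ring, as a commutative ring. *)
Definition in_centre (T : nzRingType) : {pred T} :=
  fun z => `[< forall x, z * x = x * z >].
Arguments in_centre : clear implicits.

Lemma in_centreP (T : nzRingType) (z : T) :
  reflect (forall x, z * x = x * z) (z \in in_centre T).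
Proof. exact: asboolP. Qed.

Lemma in_centre_subring (T : nzRingType) : subring_closed (in_centre T).
Proof.
split; first by apply/in_centreP => x; rewrite mul1r mulr1.
- move=> y z /in_centreP cy /in_centreP cz; apply/in_centreP => x.
  by rewrite mulrBl mulrBr cy cz.
- move=> y z /in_centreP cy /in_centreP cz; apply/in_centreP => x.
  by rewrite -mulrA cz mulrA cy mulrA.
Qed.

HB.instance Definition _ (T : nzRingType) :=
  GRing.isSubringClosed.Build T (in_centre T) (@in_centre_subring T).

Record centre (T : nzRingType) := Centre {
  centre_val :> T; centre_valP : centre_val \in in_centre T }.

Section Centre.
Variable T : nzRingType.

HB.instance Definition _ := [isSub for @centre_val T].
HB.instance Definition _ := [Choice of centre T by <:].
HB.instance Definition _ := [SubChoice_isSubNzRing of centre T by <:].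

Lemma centre_mulC : commutative (@GRing.mul (centre T)).
Proof. by move=> x y; apply: val_inj; apply: (in_centreP _ (valP x)). Qed.

HB.instance Definition _ :=
  GRing.PzRing_hasCommutativeMul.Build (centre T) centre_mulC.

End Centre.

(* T as a module over its centre. *)
Definition over_centre (T : nzRingType) : Type := T.

Section OverCentre.
Variable T : nzRingType.
Local Notation Z := (centre T).
Local Notation M := (over_centre T).

HB.instance Definition _ := GRing.Zmodule.on M.

Definition centre_scale (z : Z) (x : M) : M := (z : T) * (x : T).

Fact centre_scaleA z w x :
  centre_scale z (centre_scale w x) = centre_scale (z * w) x.
Proof. exact: mulrA. Qed.
Fact centre_scale1 : left_id 1 centre_scale. Proof. exact: mul1r. Qed.
Fact centre_scaleDr : right_distributive centre_scale +%R.
Proof. by move=> z x y; exact: (@mulrDr T). Qed.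
Fact centre_scaleDl x : {morph centre_scale^~ x : z w / z + w}.
Proof. by move=> z w; exact: (@mulrDl T). Qed.

HB.instance Definition _ := GRing.Zmodule_isLmodule.Build Z M
  centre_scaleA centre_scale1 centre_scaleDr centre_scaleDl.

End OverCentre.

(* Finitely generated modules and projective modules (the latter through the
   lifting property along surjections). *)
Definition fin_gen (R : nzRingType) (M : lmodType R) : Prop :=
  exists n (t : 'I_n -> M), forall x, exists c : 'I_n -> R,
    x = \sum_i c i *: t i.

Definition projective (R : nzRingType) (P : lmodType R) : Prop :=
  forall (M N : lmodType R) (p : {linear M -> N}) (f : {linear P -> N}),
    (forall y, exists x, p x = y) ->
    exists h : {linear P -> M}, forall x, p (h x) = f x.

(* The tensor product of two modules over a commutative ring: formal sums
   \sum_i x_i (x) y_i, encoded as lists of pairs, modulo the congruence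
   generated by the relations of the tensor product. The rule TensorZ0 turns
   the quotient monoid into a group, - (x (x) y) being (- x) (x) y. *)
Section Tensor.
Variables (R : comNzRingType) (M N : lmodType R).
Implicit Types s t : seq (M * N).

Inductive tensor_rel : seq (M * N) -> seq (M * N) -> Prop :=
| TensorRefl s : tensor_rel s s
| TensorSym s t : tensor_rel s t -> tensor_rel t s
| TensorTrans s t u : tensor_rel s t -> tensor_rel t u -> tensor_rel s u
| TensorCat s s' t t' :
    tensor_rel s s' -> tensor_rel t t' -> tensor_rel (s ++ t) (s' ++ t')
| TensorC s t : tensor_rel (s ++ t) (t ++ s)
| TensorZ0 y : tensor_rel [:: (0, y)] [::]
| TensorDl x x' y : tensor_rel [:: (x + x', y)] [:: (x, y); (x', y)]
| TensorDr x y y' : tensor_rel [:: (x, y + y')] [:: (x, y); (x, y')]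
| TensorS c x y : tensor_rel [:: (c *: x, y)] [:: (x, c *: y)].

Definition tensor_relb s t : bool := `[< tensor_rel s t >].

Fact tensor_relb_refl : reflexive tensor_relb.
Proof. by move=> s; apply/asboolP; apply: TensorRefl. Qed.
Fact tensor_relb_sym : symmetric tensor_relb.
Proof.
by move=> s t; apply: asbool_equiv_eq; split; apply: TensorSym.
Qed.
Fact tensor_relb_trans : transitive tensor_relb.
Proof.
move=> t s u /asboolP st /asboolP tu; apply/asboolP.
exact: TensorTrans st tu.
Qed.

Canonical tensor_equiv :=
  EquivRel tensor_relb tensor_relb_refl tensor_relb_sym tensor_relb_trans.

Definition tensor : Type := {eq_quot tensor_equiv}%qT.
HB.instance Definition _ := Choice.on tensor.
HB.instance Definition _ := Quotient.on tensor.

Definition tclass s : tensor := (\pi_({eq_quot tensor_equiv}) s)%qT.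

Lemma tclassP s t : tclass s = tclass t <-> tensor_rel s t.
Proof.
split=> [e|st]; first exact/asboolP/(introT (@eqmodP _ tensor_equiv s t) e).
by apply: (elimT (@eqmodP _ tensor_equiv s t)); apply/asboolP.
Qed.

Definition trepr (u : tensor) : seq (M * N) := generic_quotient.repr u.

Lemma tclass_repr (u : tensor) : tclass (trepr u) = u.
Proof. exact: reprK. Qed.

Lemma repr_tclass s : tensor_rel (trepr (tclass s)) s.
Proof. by apply/tclassP; rewrite tclass_repr. Qed.

Definition pure_tensor (x : M) (y : N) : tensor := tclass [:: (x, y)].

Definition tensor_add (u v : tensor) : tensor := tclass (trepr u ++ trepr v).
Definition tensor_opp (u : tensor) : tensor :=
  tclass [seq (- p.1, p.2) | p <- trepr u].

Lemma tclass_add s t : tensor_add (tclass s) (tclass t) = tclass (s ++ t).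
Proof. by apply/tclassP; apply: TensorCat; apply: repr_tclass. Qed.

Fact tensor_addA : associative tensor_add.
Proof.
move=> u v w; rewrite -(tclass_repr u) -(tclass_repr v) -(tclass_repr w).
by rewrite !tclass_add catA.
Qed.
Fact tensor_addC : commutative tensor_add.
Proof. by move=> u v; apply/tclassP; apply: TensorC. Qed.
Fact tensor_add0 : left_id (tclass [::]) tensor_add.
Proof. by move=> u; rewrite -(tclass_repr u) tclass_add. Qed.
Fact tensor_addN : left_inverse (tclass [::]) tensor_opp tensor_add.
Proof.
move=> u; rewrite -[X in tensor_add _ X]tclass_repr tclass_add.
elim: (trepr u) => [//|[x y] s IHs] /=.
rewrite -cat1s -[(x, y) :: s]cat1s.
have -> : tclass ([:: (- x, y)] ++ [seq (- p.1, p.2) | p <- s]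
                  ++ [:: (x, y)] ++ s)
  = tensor_add (tclass ([:: (- x, y)] ++ [:: (x, y)]))
      (tclass ([seq (- p.1, p.2) | p <- s] ++ s)).
  rewrite -!tclass_add !tensor_addA; congr tensor_add.
  by rewrite -!tensor_addA; congr tensor_add; rewrite tensor_addC.
rewrite IHs tclass_add cats0; apply/tclassP.
apply: TensorTrans (TensorZ0 y); rewrite -(addNr x).
exact: TensorSym (TensorDl _ _ _).
Qed.

HB.instance Definition _ := GRing.isZmodule.Build tensor
  tensor_addA tensor_addC tensor_add0 tensor_addN.

(* The map sending x (x) y to f x y; it depends on the chosen representatives
   unless f is bilinear, see tensor_liftE. *)
Definition tensor_lift (P : lmodType R) (f : M -> N -> P) (u : tensor) : P :=
  \sum_(p <- trepr u) f p.1 p.2.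

Definition balanced_biadditive (P : lmodType R) (f : M -> N -> P) : Prop :=
  [/\ forall x x' y, f (x + x') y = f x y + f x' y,
      forall x y y', f x (y + y') = f x y + f x y'
    & forall c x y, f (c *: x) y = f x (c *: y)].

Lemma tensor_rel_sum (P : lmodType R) (f : M -> N -> P) s t :
  balanced_biadditive f -> tensor_rel s t ->
  \sum_(p <- s) f p.1 p.2 = \sum_(p <- t) f p.1 p.2.
Proof.
move=> [fDl fDr fZ]; elim=> {s t} //=.
- by move=> s t u _ -> _ ->.
- by move=> s s' t t' _ es _ et; rewrite !big_cat /= es et.
- by move=> s t; rewrite !big_cat /= addrC.
- move=> y; rewrite big_seq1 big_nil /=.
  by apply: (addrI (f 0 y)); rewrite -fDl !addr0.
- by move=> x x' y; rewrite !big_cons !big_nil /= !addr0 fDl.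
- by move=> x y y'; rewrite !big_cons !big_nil /= !addr0 fDr.
- by move=> c x y; rewrite !big_seq1 /= fZ.
Qed.

Lemma tensor_lift_class (P : lmodType R) (f : M -> N -> P) s :
  balanced_biadditive f ->
  tensor_lift f (tclass s) = \sum_(p <- s) f p.1 p.2.
Proof. by move=> bf; apply: tensor_rel_sum bf (repr_tclass s). Qed.

Lemma tensor_liftE (P : lmodType R) (f : M -> N -> P) x y :
  balanced_biadditive f -> tensor_lift f (pure_tensor x y) = f x y.
Proof. by move=> bf; rewrite tensor_lift_class // big_seq1. Qed.

Lemma tensor_liftD (P : lmodType R) (f : M -> N -> P) u v :
  balanced_biadditive f ->
  tensor_lift f (u + v) = tensor_lift f u + tensor_lift f v.
Proof.
move=> bf; rewrite -(tclass_repr u) -(tclass_repr v) [_ + _]tclass_add.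
by rewrite !tensor_lift_class // big_cat.
Qed.

End Tensor.

Section Azumaya.
Variable T : nzRingType.
Local Notation Z := (centre T).
Local Notation M := (over_centre T).

(* The map a (x) b |-> (r |-> a r b). Here T^op is replaced by T, which is the
   same Z-module. *)
Definition azumaya_map (u : tensor M M) (r : M) : M :=
  tensor_lift (fun a b : M => (a : T) * (r : T) * (b : T) : M) u.

Lemma azumaya_map_balanced (r : M) : balanced_biadditive
  (fun a b : M => (a : T) * (r : T) * (b : T) : M).
Proof.
split=> [x x' y|x y y'|c x y].
- exact: etrans (congr1 (fun z : T => z * y) (mulrDl _ _ _)) (mulrDl _ _ _).
- exact: (@mulrDr T).
- have /in_centreP cP := valP c.
  rewrite /GRing.scale /= /centre_scale mulrA; congr (_ * _).
  by rewrite -mulrA cP.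
Qed.

Lemma azumaya_map_linear (u : tensor M M) : linear (azumaya_map u).
Proof.
move=> c r r'; rewrite /azumaya_map /tensor_lift scaler_sumr -big_split /=.
apply: eq_bigr => -[a b] _ /=; have /in_centreP cP := valP c.
rewrite [RHS]/GRing.add /= /GRing.scale /= /centre_scale.
by rewrite mulrDr mulrDl !mulrA cP.
Qed.

(* azumaya_map is always a homomorphism of rings from T (x) T^op to End_Z(T), so
   it is an isomorphism as soon as it is bijective: this is what the last two
   clauses say. *)
Definition azumaya : Prop :=
  [/\ fin_gen M, projective M,
      (forall u v : tensor M M, azumaya_map u =1 azumaya_map v -> u = v)
    & (forall f : {linear M -> M}, exists u, azumaya_map u =1 f)].

(* The submodule mT. *)
Definition ideal_span (m : set Z) : set M :=
  [set x | exists n (c : 'I_n -> Z) (t : 'I_n -> M),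
     (forall i, m (c i)) /\ x = \sum_i c i *: t i].

(* The dimension of T/mT over Z/m is n: there are n elements of T whose classes
   form a basis of T/mT over Z/m. *)
Definition fibre_dim (m : set Z) (n : nat) : Prop :=
  exists t : 'I_n -> M,
    (forall x, exists c : 'I_n -> Z, ideal_span m (x - \sum_i c i *: t i)) /\
    (forall c : 'I_n -> Z,
       ideal_span m (\sum_i c i *: t i) -> forall i, m (c i)).

Definition has_rank (n : nat) : Prop :=
  forall m : set Z, maximal_ideal m -> fibre_dim m n.

End Azumaya.

Arguments azumaya : clear implicits.
Arguments has_rank : clear implicits.

(* Main.v *)
Require Import Defs.
From HB Require Import structures.
From mathcomp Require Import all_boot all_fingroup all_algebra.
From mathcomp Require Import boolp classical_sets.
From mathcomp Require Import ring.

Set Implicit Arguments.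
Unset Strict Implicit.
Unset Printing Implicit Defensive.

(** Let T = A # G, with A a noetherian domain and G acting faithfully.

    T is prime because every nonzero ideal I of T meets A. If x in I has
    minimal support and a nonzero coefficient at 1, then x a - a x has a
    smaller support for each a in A, so that it vanishes; as G acts
    faithfully and A is a domain, x is supported at 1
    ([ideal_meets_base]). T is noetherian because it is a free A-module of
    finite rank on either side ([acc_coef_stable]).

    The Azumaya property is compared with two conditions on the action. The
    inertia group of a maximal ideal m consists of the g that act trivially on
    A/m. A Galois system consists of finitely many x_i and y_i in A such that
    sum_i x_i g(y_i) is 1 if g = 1 and 0 otherwise. The implications are

      free action => trivial inertia groups => Galois system => Azumaya
                  => trivial inertia groups,

    and trivial inertia groups => free action if every residue field is k,
    since then an element of G that stabilises m acts trivially on A/m = k.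

    - Trivial inertia gives a Galois system ([galois_system_exists]): for
      g <> 1 no maximal ideal contains all the a - g(a), so that they generate
      the unit ideal; this gives a system that separates g from 1, and
      the product of these systems is a Galois system.
    - A Galois system gives explicit dual bases of T over its centre. The
      elements x_l h generate T, and the coordinate of r = sum_h r_h h at
      x_l h is tr(y_l r_h), where tr is the trace from A to its invariant ring
      A^G. Each coordinate is an inner map r |-> sum p r q, which yields an
      inverse of the map from the tensor square of T to End(T)
      ([azumaya_criterion], [galois_azumaya]).
    - If T is Azumaya, every ideal J of T is contained in (J meet Z) T, with Z
      the centre of T ([azumaya_ideal_central]). If the inertia group H of m
      contains h0 <> 1, this fails for the annihilator J of the T-module
      induced from the A # H-module A/m: the central elements of J lie in m,
      but J contains e (h0 - 1) for some e outside m ([azumaya_inertia]).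

    For the rank, a minimal spanning set of T modulo a maximal ideal n of Z is
    a basis of T/nT, and if it has d elements, the trace of the identity of the
    projective module T is d modulo n ([fibre_dim_trace]). For the dual bases above this trace is |G|^2
    ([galois_coord_trace]), and in characteristic 0 this determines d. *)

Import GRing.Theory.
Local Open Scope ring_scope.
Local Open Scope classical_set_scope.

(** * Maximal ideals of commutative rings *)
Section CommutativeIdeals.
Variable R : comNzRingType.
Implicit Types (I m : set R).

Lemma left_ideal_two_sided I : left_ideal I -> two_sided_ideal I.
Proof.
by move=> [I0 ID IM]; split; split=> // r x Ix; rewrite mulrC; apply: IM.
Qed.

Lemma left_idealB (T : nzRingType) (I : set T) x y :
  left_ideal I -> I x -> I y -> I (x - y).
Proof.
by move=> [_ ID IM] Ix Iy; rewrite -mulN1r; apply: ID => //; apply: IM.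
Qed.

Lemma left_ideal_sum (T : nzRingType) (I : set T) (K : Type) (s : seq K)
    (P : pred K) (F : K -> T) :
  left_ideal I -> (forall i, P i -> I (F i)) -> I (\sum_(i <- s | P i) F i).
Proof. by case=> I0 ID _ IF; elim/big_rec: _ => // i x /IF; apply: ID. Qed.

Lemma maximal_left_ideal m : maximal_ideal m -> left_ideal m.
Proof. by case=> -[]. Qed.

(** Otherwise m + R a would be a proper ideal above m, hence equal to m. *)
Lemma maximal_inv m a :
  maximal_ideal m -> ~ m a -> exists b, m (1 - b * a).
Proof.
move=> maxm ma; have mL := maximal_left_ideal maxm.
case: maxm => _ m1 mmax; have [m0 mD mM] := mL.
pose J : set R := [set x | exists b, m (x - b * a)].
have JL : left_ideal J.
  split=> [|x y [b mb] [c mc]|r x [b mb]].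
  - by exists 0; rewrite mul0r subr0.
  - by exists (b + c); rewrite mulrDl opprD addrACA; apply: mD.
  - by exists (r * b); rewrite -mulrA -mulrBr; apply: mM.
apply: contrapT => J1; apply: ma.
rewrite -(mmax J (left_ideal_two_sided JL)) //.
  by exists 1; rewrite mul1r subrr.
by move=> x mx; exists 0; rewrite mul0r subr0.
Qed.

Lemma maximal_prime m a b :
  maximal_ideal m -> ~ m a -> ~ m b -> ~ m (a * b).
Proof.
move=> maxm ma mb mab; have [_ mD mM] := maximal_left_ideal maxm.
have [c mc] := maximal_inv maxm ma; apply: mb.
have -> : b = b * (1 - c * a) + c * (a * b) by ring.
by apply: mD; apply: mM.
Qed.

Lemma maximal_prod m (K : Type) (s : seq K) (P : pred K) (F : K -> R) :
  maximal_ideal m -> (forall i, P i -> ~ m (F i)) ->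
  ~ m (\prod_(i <- s | P i) F i).
Proof.
move=> maxm mF; elim/big_rec: _ => [|i x /mF]; first by case: maxm.
exact: maximal_prime.
Qed.

(** If no proper ideal above I were maximal, a choice of strictly larger proper
    ideals would give a strictly ascending chain. *)
Lemma noetherian_maximal_ideal I :
  noetherian R -> left_ideal I -> ~ I 1 ->
  exists m, maximal_ideal m /\ I `<=` m.
Proof.
move=> [accR _] IL I1; apply: contrapT => nomax.
pose proper J := [/\ left_ideal J, ~ J 1 & I `<=` J].
have grow (J : {J | proper J}) :
    exists K : {J | proper J}, sval J `<=` sval K /\ sval K <> sval J.
  case: J => J [JL J1 IJ] /=; apply: contrapT => noK; apply: nomax.
  exists J; split=> //; split=> //; first exact: left_ideal_two_sided.
  move=> K [KL _] K1 JK; apply: contrapT => KJ; apply: noK.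
  by exists (exist proper K (And3 KL K1 (subset_trans IJ JK))).
have [next nextP] := choice grow.
pose chain n := iter n next (exist proper I (And3 IL I1 (@subset_refl _ I))).
have [|n|N stable] := accR (fun n => sval (chain n)).
- by move=> n; case: (svalP (chain n)).
- exact: (nextP (chain n)).1.
- exact: (nextP (chain N)).2 (stable N.+1 (leqnSn N)).
Qed.

End CommutativeIdeals.

(** * Coefficients in a skew group ring *)
Section Skew.
Variables (G : finGroupType) (A : nzRingType) (act : ring_action G A).
Local Notation T := (skew_ring act).
Implicit Types (x y : T) (a b : A) (g h : G).

Lemma skewD x y g : (x + y) g = x g + y g. Proof. by rewrite [LHS]ffunE. Qed.
Lemma skewB x y g : (x - y) g = x g - y g.
Proof. by rewrite [LHS]ffunE /= [X in _ + X]ffunE. Qed.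

Lemma skew0 g : (0 : T) g = 0. Proof. by rewrite [LHS]ffunE. Qed.

Lemma skew_sumE (K : Type) (s : seq K) (P : pred K) (F : K -> T) g :
  (\sum_(i <- s | P i) F i) g = \sum_(i <- s | P i) (F i) g.
Proof.
by apply: (big_morph (fun x : T => x g)) => [x y|]; rewrite ?skewD ?skew0.
Qed.

Lemma skew_monoE a g h : skew_mono act a g h = if h == g then a else 0.
Proof. by rewrite [LHS]ffunE. Qed.

Lemma skew_mulE x y k : (x * y) k = \sum_g x g * act g (y (g^-1 * k)%g).
Proof. by rewrite [LHS]ffunE. Qed.

Lemma mono_mulE a g x k :
  (skew_mono act a g * x) k = a * act g (x (g^-1 * k)%g).
Proof.
rewrite skew_mulE (bigD1 g) //= big1 => [|h hg].
  by rewrite skew_monoE eqxx addr0.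
by rewrite skew_monoE (negPf hg) mul0r.
Qed.

Lemma mul_monoE x a g k :
  (x * skew_mono act a g) k = x (k * g^-1)%g * act (k * g^-1)%g a.
Proof.
rewrite skew_mulE (bigD1 (k * g^-1)%g) //= big1 => [|h hg].
  by rewrite skew_monoE invMg invgK mulgKV eqxx addr0.
rewrite skew_monoE; case: eqP => [e|]; last by rewrite rmorph0 mulr0.
by case/eqP: hg; rewrite -e invMg invgK mulKVg.
Qed.

Lemma skew_monoD a b g :
  skew_mono act (a + b) g = skew_mono act a g + skew_mono act b g.
Proof.
by apply/ffunP=> h; rewrite skewD !skew_monoE; case: eqP; rewrite ?addr0.
Qed.

Lemma skew_mono_sum (K : Type) (s : seq K) (P : pred K) (F : K -> A) g :
  skew_mono act (\sum_(i <- s | P i) F i) g =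
  \sum_(i <- s | P i) skew_mono act (F i) g.
Proof.
apply: (big_morph (fun a => skew_mono act a g)) => [a b|].
  exact: skew_monoD.
by apply/ffunP=> h; rewrite skew0 skew_monoE; case: eqP.
Qed.

Lemma skew_mono0 g : skew_mono act 0 g = 0.
Proof. by apply/ffunP=> h; rewrite skew0 skew_monoE; case: eqP. Qed.

Lemma skew_mono_nat n : skew_mono act n%:R 1%g = n%:R.
Proof.
by elim: n => [|n IHn]; rewrite ?skew_mono0 // !mulrS skew_monoD IHn.
Qed.

Lemma ractK g : cancel (act g) (act g^-1%g).
Proof. by move=> a; rewrite -ractM mulVg ract1. Qed.

Lemma ractVK g : cancel (act g^-1%g) (act g).
Proof. by move=> a; rewrite -ractM mulgV ract1. Qed.

End Skew.

(** * Skew group rings over noetherian rings *)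
Section Noetherian.
Variables (G : finGroupType) (A : comNzRingType) (act : ring_action G A).
Local Notation T := (skew_ring act).

(** The common feature of left and right ideals of the skew group ring: any
    single coefficient can be scaled inside I without enlarging the support. A
    right multiplication by a scales the coefficient at g by g(a), which is
    arbitrary because g is bijective on A. *)
Definition coef_stable (I : set T) : Prop :=
  [/\ I 0, forall x y, I x -> I y -> I (x - y)
    & forall a g x, I x -> exists y, [/\ I y, y g = a * x g
        & forall h, x h = 0 -> y h = 0]].

(** The enumeration order of G serves here as an arbitrary total order. *)
Definition lead_ideal (g : G) (I : set T) : set A :=
  [set a | exists x, [/\ I x, x g = a
     & forall h, (enum_rank g < enum_rank h)%N -> x h = 0]].

Lemma lead_ideal_ideal g I : coef_stable I -> left_ideal (lead_ideal g I).
Proof.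
move=> [I0 IB IM]; split.
- by exists 0; split=> // *; rewrite skew0.
- move=> _ _ [x [Ix <- x0]] [y [Iy <- y0]]; exists (x - (0 - y)); split.
  + by apply: (IB) => //; apply: IB.
  + by rewrite !skewB skew0 sub0r opprK.
  + by move=> h gh; rewrite !skewB skew0 x0 ?y0 // !subr0.
- move=> r _ [x [Ix <- x0]]; have [y [Iy yg y0]] := IM r g x Ix.
  by exists y; split=> // h /x0; apply: y0.
Qed.

Lemma lead_idealS g (I J : set T) :
  I `<=` J -> lead_ideal g I `<=` lead_ideal g J.
Proof. by move=> IJ a [x [/IJ Jx xg x0]]; exists x. Qed.

(** An element x of J is reduced to 0 from its leading term down: an element
    y of I with the same leading coefficient is subtracted, and x - y has a
    smaller leading term. *)
Lemma lead_ideal_eq (I J : set T) :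
  coef_stable I -> coef_stable J -> I `<=` J ->
  (forall g, lead_ideal g J = lead_ideal g I) -> J = I.
Proof.
move=> [I0 IB IM] [J0 JB JM] IJ lead; apply/seteqP; split=> // x.
suff sub n : forall x, J x -> (forall h, (n <= enum_rank h)%N -> x h = 0) -> I x.
  by move=> Jx; apply: (sub #|G|) => // h; rewrite leqNgt ltn_ord.
elim: n => [|n IHn] {}x Jx x0.
  by have -> : x = 0 by apply/ffunP=> h; rewrite x0 // skew0.
have [n_lt|n_ge] := ltnP n #|G|; last first.
  by apply: IHn => // h; rewrite leqNgt (leq_trans (ltn_ord _) n_ge).
pose g : G := enum_val (Ordinal n_lt).
have rg : enum_rank g = n :> nat by rewrite enum_valK.
have : lead_ideal g J (x g) by exists x; split=> // h; rewrite rg; apply: x0.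
rewrite lead => -[y [Iy yg y0]].
have Ixy : I (x - y).
  apply: IHn => [|h]; first by apply: JB => //; apply: IJ.
  rewrite skewB leq_eqVlt => /predU1P[nh|nh].
    suff <- : g = h by rewrite yg subrr.
    by apply: enum_rank_inj; apply: val_inj; rewrite /= rg.
  by rewrite x0 // y0 ?subr0 // rg.
have -> : x = (x - y) - (0 - y) by rewrite sub0r opprK subrK.
by apply: (IB) => //; apply: IB.
Qed.

(** For each of the finitely many g, the ideals of leading coefficients at g
    become stationary; from the largest of these indices on, the chain is
    constant. *)
Lemma acc_coef_stable (P : set T -> Prop) :
  noetherian A -> (forall I, P I -> coef_stable I) -> acc P.
Proof.
move=> [accA _] PS I PI Imono.
have Ile a b : (a <= b)%N -> I a `<=` I b.
  elim: b => [|b IHb]; first by rewrite leqn0 => /eqP ->.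
  rewrite leq_eqVlt => /predU1P[-> //|/IHb ab].
  exact: subset_trans ab (Imono b).
have stab g : exists N, forall n, (N <= n)%N ->
    lead_ideal g (I n) = lead_ideal g (I N).
  apply: accA => n; first exact/lead_ideal_ideal/PS.
  exact: lead_idealS.
have [N NP] := choice stab.
exists (\max_g N g)%N => n Nn; apply: lead_ideal_eq.
- exact: PS.
- exact: PS.
- exact: Ile.
- move=> g; have le_g : (N g <= \max_g N g)%N by apply: (leq_bigmax (F := N)).
  by rewrite (NP g n) ?(leq_trans le_g) // (NP g (\max_g N g)%N).
Qed.

Lemma skew_noetherian : noetherian A -> noetherian T.
Proof.
move=> noethA; split; apply: acc_coef_stable => // I [I0 ID IM]; split=> //.
- by move=> x y Ix Iy; rewrite -mulN1r; apply: ID => //; apply: IM.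
- move=> a g x Ix; exists (skew_mono act a 1%g * x); split; first exact: IM.
    by rewrite mono_mulE invg1 mul1g ract1.
  by move=> h xh; rewrite mono_mulE invg1 mul1g ract1 xh mulr0.
- by move=> x y Ix Iy; rewrite -mulrN1; apply: ID => //; apply: IM.
- move=> a g x Ix; exists (x * skew_mono act (act g^-1%g a) 1%g).
  split; first exact: IM.
    by rewrite mul_monoE invg1 mulg1 ractVK mulrC.
  by move=> h xh; rewrite mul_monoE invg1 mulg1 xh mul0r.
Qed.

End Noetherian.

(** * Prime skew group rings and their centres *)
Section DomainFaithful.
Variables (G : finGroupType) (A : comNzRingType) (act : ring_action G A).
Hypothesis domain_A : GRing.integral_domain_axiom A.
Hypothesis act_faithful : faithful_action act.
Local Notation T := (skew_ring act).

Lemma domain_mulf_neq0 (a b : A) : a <> 0 -> b <> 0 -> a * b <> 0.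
Proof. by move=> a0 b0 /domain_A/orP[/eqP|/eqP]. Qed.

Lemma faithful_moves g : g != 1%g -> exists a, act g a - a <> 0.
Proof.
move=> /eqP g1; apply: contrapT => fix_g; apply: g1; apply: act_faithful => a.
by apply: contrapT => ga; apply: fix_g; exists a => /subr0_eq.
Qed.

(** A commutator with a in A has coefficient 0 at 1, and over a domain the
    support of x loses only those g that fix a. *)
Lemma commutator_mono1E (x : T) a g :
  (x * skew_mono act a 1%g - skew_mono act a 1%g * x) g = x g * (act g a - a).
Proof.
by rewrite skewB mul_monoE mono_mulE !invg1 mulg1 mul1g ract1 mulrBr (mulrC a).
Qed.

(** The induction is on the size of the support, for elements normalised by a
    right translation to have a nonzero coefficient at 1. If another coefficient
    at h is nonzero, the commutator with an a moved by h has a smaller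
    support. *)
Lemma ideal_meets_base (I : set T) x :
  two_sided_ideal I -> I x -> x <> 0 -> exists2 a, a <> 0 & I (skew_mono act a 1%g).
Proof.
move=> [IL [_ _ IMr]] Ix x0; have [_ _ IMl] := IL.
pose supp (x : T) := [pred g | x g != 0].
have shiftE (y : T) h g : (y * skew_mono act 1 h^-1%g) g = y (g * h)%g.
  by rewrite mul_monoE invgK rmorph1 mulr1.
have [g xg] : exists g, x g <> 0.
  apply: contrapT => x_0; apply: x0; apply/ffunP => g; rewrite skew0.
  by apply: contrapT => xg; apply: x_0; exists g.
suff minimal n (y : T) :
    (#|supp y| <= n)%N -> I y -> y 1%g <> 0 ->
    exists2 a, a <> 0 & I (skew_mono act a 1%g).
  apply: (minimal _ (x * skew_mono act 1 g^-1%g) (leqnn _)); first exact: IMr.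
  by rewrite shiftE mul1g.
elim: n y => [|n IHn] y.
  rewrite leqn0 => /eqP/card0_eq/(_ 1%g) y0 _ /eqP.
  by have:= y0; rewrite !inE => ->.
move=> card_y Iy y1.
have [[h h1 yh]|only1] := pselect (exists2 h, h != 1%g & y h <> 0).
  have [a ha] := faithful_moves h1.
  pose z : T := y * skew_mono act a 1%g - skew_mono act a 1%g * y.
  have Iz : I z by apply: left_idealB => //; [apply: IMr | apply: IMl].
  apply: (IHn (z * skew_mono act 1 h^-1%g)); last 2 first.
  - exact: IMr.
  - by rewrite shiftE mul1g commutator_mono1E; apply: domain_mulf_neq0.
  rewrite -ltnS; apply: leq_trans card_y.
  rewrite -(card_image (mulIg h)); apply: (@leq_ltn_trans #|supp z|).
    apply: subset_leq_card; apply/fintype.subsetP=> _ /fintype.imageP[k zk ->].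
    by rewrite inE -shiftE.
  apply: proper_card; apply/properP; split.
    apply/fintype.subsetP=> k; rewrite !inE commutator_mono1E.
    by apply: contraNneq => ->; rewrite mul0r.
  exists 1%g; rewrite !inE; first exact/eqP.
  by rewrite commutator_mono1E ract1 subrr mulr0 eqxx.
exists (y 1%g) => //; suff <- : y = skew_mono act (y 1%g) 1%g by [].
apply/ffunP=> h; rewrite skew_monoE; case: eqP => [->//|/eqP h1].
by apply: contrapT => yh; apply: only1; exists h.
Qed.

Lemma skew_prime : prime_ring T.
Proof.
move=> I J idI idJ IJ0; apply: contrapT => /not_orP[nI nJ].
have nonzero (K : set T) : ~ (K `<=` [set 0]) -> exists2 x, K x & x <> 0.
  move=> K0; apply: contrapT => noK; apply: K0 => x Kx.
  by apply: contrapT => x0; apply: noK; exists x.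
have [x Ix /(ideal_meets_base idI Ix)[a a0 Ia]] := nonzero I nI.
have [y Jy /(ideal_meets_base idJ Jy)[b b0 Jb]] := nonzero J nJ.
have := IJ0 _ _ Ia Jb; rewrite skew_monoM ract1 mulg1 => /ffunP/(_ 1%g).
by rewrite skew_monoE skew0 eqxx; apply: domain_mulf_neq0.
Qed.

Lemma centre_support (z : centre T) (g : G) : g != 1%g -> (centre_val z : T) g = 0.
Proof.
move=> /faithful_moves[a ga]; have /in_centreP cz := valP z.
apply: contrapT => zg; apply: (domain_mulf_neq0 zg ga).
by rewrite -commutator_mono1E cz subrr skew0.
Qed.

End DomainFaithful.

(** * Dual bases of projective modules *)
Section DualBasis.
Variables (R : comNzRingType) (M : lmodType R).

(** The functionals f j are bare functions, each with its linearity as a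
    hypothesis, so that explicit formulas can be given for them. *)
Definition dual_basis (J : finType) (t : J -> M) (f : J -> M -> R) : Prop :=
  (forall j c x y, f j (c *: x + y) = c * f j x + f j y) /\
  (forall x, x = \sum_j f j x *: t j).

Section Combination.
Variables (N : lmodType R) (n : nat) (v : 'I_n -> N).

Definition combination (c : 'rV[R]_n) : N := \sum_i c 0 i *: v i.

Fact combination_linear : linear combination.
Proof.
move=> a c d; rewrite /combination scaler_sumr -big_split /=.
by apply: eq_bigr => i _; rewrite !mxE scalerDl scalerA.
Qed.

HB.instance Definition _ :=
  GRing.isLinear.Build R 'rV[R]_n N _ combination combination_linear.

End Combination.

(** Generators of M give a surjection from a free module onto M; the
    coordinates of a section of it are the functionals. *)
Lemma projective_dual_basis :
  fin_gen M -> projective M ->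
  exists n (t : 'I_n -> M) (f : 'I_n -> M -> R), dual_basis t f.
Proof.
move=> [n [t gen]] projM.
have [|h hK] := projM _ _ (combination t) (idfun : {linear M -> M}).
  move=> y; have [c ->] := gen y; exists (\row_i c i).
  by apply: eq_bigr => i _; rewrite mxE.
exists n, t, (fun i x => h x 0 i); split=> [i c x y|x].
  by rewrite linearP !mxE.
exact: (esym (hK x)).
Qed.

Variables (J : finType) (t : J -> M) (f : J -> M -> R).
Hypothesis tf : dual_basis t f.

Lemma dual_basisP j c x y : f j (c *: x + y) = c * f j x + f j y.
Proof. exact: tf.1. Qed.

Lemma dual_basis0 j : f j 0 = 0.
Proof.
have := dual_basisP j 1 0 0; rewrite scale1r addr0 mul1r => /eqP.
by rewrite -subr_eq0 opprD addNKr oppr_eq0 => /eqP.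
Qed.

Lemma dual_basisD j x y : f j (x + y) = f j x + f j y.
Proof. by rewrite -{1}(scale1r x) dual_basisP mul1r. Qed.

Lemma dual_basisZ j c x : f j (c *: x) = c * f j x.
Proof. by rewrite -[c *: x]addr0 dual_basisP dual_basis0 addr0. Qed.

Lemma dual_basis_sum j (K : Type) (s : seq K) (P : pred K) (F : K -> M) :
  f j (\sum_(i <- s | P i) F i) = \sum_(i <- s | P i) f j (F i).
Proof. exact: (big_morph (f j) (dual_basisD j) (dual_basis0 j)). Qed.

Lemma dual_basis_fin_gen : fin_gen M.
Proof.
exists #|J|, (fun i => t (enum_val i)) => x.
exists (fun i => f (enum_val i) x).
by rewrite {1}(tf.2 x) (reindex _ (onW_bij _ (enum_val_bij J))).
Qed.

(** A map is lifted by choosing preimages of the images of the t j. *)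
Lemma dual_basis_projective : projective M.
Proof.
move=> N P p g p_onto.
have [m mP] := choice (fun j => p_onto (g (t j))).
pose h x := \sum_j f j x *: m j.
have h_linear : linear h.
  move=> c x y; rewrite /h scaler_sumr -big_split /=.
  by apply: eq_bigr => j _; rewrite dual_basisP scalerDl scalerA.
exists (HB.pack_for {linear M -> N} h (GRing.isLinear.Build R M N _ h h_linear)).
move=> x /=; rewrite [in RHS](tf.2 x) /h !linear_sum /=.
by apply: eq_bigr => j _; rewrite !linearZ /= mP.
Qed.

End DualBasis.

(** * Azumaya rings *)
Section PureTensors.
Variables (R : comNzRingType) (M N : lmodType R).

Lemma pure_tensorDl (x x' : M) (y : N) :
  pure_tensor (x + x') y = pure_tensor x y + pure_tensor x' y.
Proof. by rewrite [RHS]tclass_add; apply/tclassP; apply: TensorDl. Qed.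

Lemma pure_tensorDr (x : M) (y y' : N) :
  pure_tensor x (y + y') = pure_tensor x y + pure_tensor x y'.
Proof. by rewrite [RHS]tclass_add; apply/tclassP; apply: TensorDr. Qed.

Lemma pure_tensorZ c (x : M) (y : N) :
  pure_tensor (c *: x) y = pure_tensor x (c *: y).
Proof. by apply/tclassP; apply: TensorS. Qed.

Lemma pure_tensor0l (y : N) : pure_tensor (0 : M) y = 0.
Proof. by apply: (addrI (pure_tensor 0 y)); rewrite -pure_tensorDl !addr0. Qed.

Lemma pure_tensor0r (x : M) : pure_tensor x (0 : N) = 0.
Proof. by apply: (addrI (pure_tensor x 0)); rewrite -pure_tensorDr !addr0. Qed.

Lemma pure_tensor_suml (K : Type) (s : seq K) (F : K -> M) (y : N) :
  pure_tensor (\sum_(i <- s) F i) y = \sum_(i <- s) pure_tensor (F i) y.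
Proof.
apply: (big_morph (fun x => pure_tensor x y)) => [x x'|].
  exact: pure_tensorDl.
exact: pure_tensor0l.
Qed.

Lemma pure_tensor_sumr (K : Type) (s : seq K) (x : M) (F : K -> N) :
  pure_tensor x (\sum_(i <- s) F i) = \sum_(i <- s) pure_tensor x (F i).
Proof. exact: (big_morph _ (pure_tensorDr x) (pure_tensor0r x)). Qed.

Lemma tensor_pure_sum (u : tensor M N) :
  u = \sum_(p <- trepr u) pure_tensor p.1 p.2.
Proof.
rewrite -{1}(tclass_repr u); elim: (trepr u) => [|[x y] s IHs].
  by rewrite big_nil.
by rewrite big_cons -IHs [RHS]tclass_add.
Qed.

End PureTensors.

Section Azumaya.
Variable T : nzRingType.
Local Notation Z := (centre T).
Local Notation M := (over_centre T).

Lemma centre_scaleE (z : Z) (x : T) : z *: (x : M) = centre_val z * x.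
Proof. by []. Qed.

Lemma azumaya_map_pure (a b r : T) :
  azumaya_map (pure_tensor (a : M) (b : M)) r = a * r * b.
Proof. exact: (tensor_liftE _ _ (azumaya_map_balanced r)). Qed.

Lemma azumaya_mapD (u v : tensor M M) (r : M) :
  azumaya_map (u + v) r = azumaya_map u r + azumaya_map v r.
Proof. exact: (tensor_liftD _ _ (azumaya_map_balanced r)). Qed.

Lemma azumaya_map_sum (K : Type) (s : seq K) (F : K -> tensor M M) (r : M) :
  azumaya_map (\sum_(i <- s) F i) r = \sum_(i <- s) azumaya_map (F i) r.
Proof.
apply: (big_morph (fun u => azumaya_map u r)) => [u v|].
  exact: azumaya_mapD.
by apply: (addrI (azumaya_map 0 r)); rewrite -azumaya_mapD !addr0.
Qed.

Lemma azumaya_map_ideal (I : set T) (u : tensor M M) (r : T) :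
  two_sided_ideal I -> I r -> I (azumaya_map u r).
Proof.
move=> [IL [_ _ IMr]] Ir; have [_ _ IMl] := IL.
rewrite [u]tensor_pure_sum azumaya_map_sum; apply: (left_ideal_sum _ IL) => i _.
by rewrite azumaya_map_pure; apply/IMr/IMl.
Qed.

(** Each coordinate of T over its centre is an endomorphism of T, hence of the
    form r |-> sum a r b; it therefore maps the ideal I into I, so that the
    coordinates of r are central elements of I. *)
Lemma azumaya_ideal_central (I : set T) (r : T) :
  azumaya T -> two_sided_ideal I -> I r ->
  ideal_span [set z : Z | I z] (r : M).
Proof.
move=> [fgT projT _ azu_surj] idI Ir.
have [n [t [f tf]]] := projective_dual_basis fgT projT.
exists n, (fun i => f i r), t; split=> [i|]; last exact: tf.2.
pose F (x : M) : M := f i x *: ((1 : T) : M).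
have F_linear : linear F.
  by move=> c x y; rewrite /F (dual_basisP tf) scalerDl scalerA.
pose FL := HB.pack_for {linear M -> M} F (GRing.isLinear.Build Z M M _ F F_linear).
have [u uP] := azu_surj FL.
have := azumaya_map_ideal u idI Ir; rewrite uP.
by rewrite /= /F centre_scaleE mulr1.
Qed.

(** An endomorphism F is recovered from its values F(t j) as
    sum_j sum_l p j l (x) q j l F(t j). The first hypothesis says that the
    coordinates f j are inner and central, the second that this recipe sends
    r |-> a r b to a (x) b; together they make it a two-sided inverse of the map
    from the tensor square of T to its endomorphisms. *)
Section Criterion.
Variables (J L : finType) (p q : J -> L -> T) (t : J -> T) (f : J -> T -> Z).
Hypothesis coord_inner :
  forall j r, (f j r : T) = \sum_l p j l * r * q j l.
Hypothesis tensor_expansion : forall a b : T,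
  \sum_j \sum_l pure_tensor (p j l : M) (q j l * (a * t j * b) : M)
    = pure_tensor (a : M) (b : M).

(** The expansion r = sum_j f_j(r) t_j is the value at r of the endomorphism
    attached to the second hypothesis with a = b = 1. *)
Lemma criterion_dual_basis : @dual_basis Z M J t f.
Proof.
split=> [j c x y|x].
  apply: val_inj; rewrite /= [RHS]/= !coord_inner.
  rewrite mulr_sumr -big_split; apply: eq_bigr => l _ /=.
  have /in_centreP cP := valP c.
  rewrite centre_scaleE.
  by rewrite mulrDr mulrDl !mulrA cP.
have := congr1 (fun u => azumaya_map u (x : M)) (tensor_expansion 1 1).
rewrite azumaya_map_pure mul1r mulr1 => /esym xE; rewrite [LHS]xE.
rewrite azumaya_map_sum; apply: eq_bigr => j _.
rewrite azumaya_map_sum centre_scaleE coord_inner mulr_suml.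
apply: eq_bigr => l _; rewrite azumaya_map_pure.
by rewrite mul1r mulr1 !mulrA.
Qed.

Lemma azumaya_criterion : azumaya T.
Proof.
have tf := criterion_dual_basis.
pose inv (F : M -> M) : tensor M M :=
  \sum_j \sum_l pure_tensor (p j l : M) (q j l * F (t j) : M).
have invK u : inv (azumaya_map u) = u.
  rewrite [RHS]tensor_pure_sum.
  under [RHS]eq_bigr => ab _ do rewrite -tensor_expansion.
  rewrite [RHS]exchange_big; apply: eq_bigr => j _.
  rewrite [RHS]exchange_big; apply: eq_bigr => l _.
  rewrite -pure_tensor_sumr; congr pure_tensor.
  by rewrite -[RHS]mulr_sumr.
split.
- exact: dual_basis_fin_gen tf.
- exact: dual_basis_projective tf.
- move=> u v uv; rewrite -[u]invK -[v]invK /inv.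
  by apply: eq_bigr => j _; apply: eq_bigr => l _; rewrite uv.
- move=> F; exists (inv F) => r.
  rewrite [in RHS](tf.2 r) linear_sum azumaya_map_sum; apply: eq_bigr => j _.
  rewrite linearZ /= azumaya_map_sum centre_scaleE.
  rewrite coord_inner mulr_suml; apply: eq_bigr => l _.
  by rewrite azumaya_map_pure !mulrA.
Qed.

End Criterion.

(** * Dimension of the fibres of a projective module *)
Section FibreDimension.
Variables (J : finType) (t : J -> M) (f : J -> M -> Z).
Hypothesis tf : dual_basis t f.
Variable m : set Z.
Hypothesis max_m : maximal_ideal m.

Let mL : left_ideal m := maximal_left_ideal max_m.

(** Membership in mT can be tested on coordinates, which reduces the closure
    properties of mT to those of m. *)
Lemma ideal_spanP (x : M) : ideal_span m x <-> forall j, m (f j x).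
Proof.
have [m0 mD mM] := mL; split=> [[n [c [s [mc ->]]]] j|mf].
  rewrite (dual_basis_sum tf); apply: (left_ideal_sum _ mL) => i _.
  by rewrite (dual_basisZ tf) mulrC; apply: mM.
exists #|J|, (fun i => f (enum_val i) x), (fun i => t (enum_val i)).
split=> //; rewrite {1}(tf.2 x).
by rewrite (reindex _ (onW_bij _ (enum_val_bij J))).
Qed.

Lemma ideal_spanD x y :
  ideal_span m x -> ideal_span m y -> ideal_span m (x + y).
Proof.
move=> /ideal_spanP mx /ideal_spanP my; apply/ideal_spanP => j.
by have [_ mD _] := mL; rewrite (dual_basisD tf); apply: mD.
Qed.

Lemma ideal_spanZ c x : ideal_span m x -> ideal_span m (c *: x).
Proof.
move=> /ideal_spanP mx; apply/ideal_spanP => j.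
by have [_ _ mM] := mL; rewrite (dual_basisZ tf); apply: mM.
Qed.

Lemma ideal_spanZm c x : m c -> ideal_span m (c *: x).
Proof.
move=> mc; apply/ideal_spanP => j.
by have [_ _ mM] := mL; rewrite (dual_basisZ tf) mulrC; apply: mM.
Qed.

Lemma ideal_span_sum (K : Type) (s : seq K) (F : K -> M) :
  (forall i, ideal_span m (F i)) -> ideal_span m (\sum_(i <- s) F i).
Proof.
move=> mF; elim/big_rec: _ => [|i x _]; last exact: ideal_spanD.
by rewrite -(scale0r 0); apply: ideal_spanZm; case: mL.
Qed.

Definition spans_fibre n (b : 'I_n -> M) : Prop :=
  forall x, exists c : 'I_n -> Z, ideal_span m (x - \sum_i c i *: b i).

(** Modulo m the coefficient c i is invertible, so that b i is a combination of
    the other b k. *)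
Lemma spans_fibre_shrink n (b : 'I_n.+1 -> M) (c : 'I_n.+1 -> Z) i :
  spans_fibre b -> ideal_span m (\sum_k c k *: b k) -> ~ m (c i) ->
  spans_fibre (fun k => b (lift i k)).
Proof.
move=> span_b rel_c /(maximal_inv max_m)[d md] x.
have [a xa] := span_b x.
exists (fun k => a (lift i k) - a i * d * c (lift i k)).
have -> : x - \sum_k (a (lift i k) - a i * d * c (lift i k)) *: b (lift i k)
    = (x - \sum_k a k *: b k) + (a i * d) *: (\sum_k c k *: b k)
      + (a i * (1 - d * c i)) *: b i.
  under eq_bigr => k _ do rewrite scalerBl -scalerA.
  rewrite sumrB -scaler_sumr [\sum_k a k *: _](bigD1_ord i) //=.
  rewrite [\sum_k c k *: _](bigD1_ord i) //= scalerDr scalerA.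
  rewrite mulrBr mulr1 scalerBl mulrA !opprD opprK !addrA.
  set u := \sum_k a _ *: _; set v := _ *: \sum_k _.
  rewrite [RHS]addrAC [in RHS](addrAC _ v) addrK.
  by rewrite [in RHS](addrAC x) [RHS]addrAC subrK.
apply: ideal_spanD; first by apply/ideal_spanD/ideal_spanZ.
by apply: ideal_spanZm; case: mL => _ _; apply.
Qed.

(** A spanning family of minimal length is a basis. *)
Lemma fibre_dim_exists : exists d, fibre_dim m d.
Proof.
pose spanning n := `[< exists b : 'I_n -> M, spans_fibre b >].
have ex_span : exists n, spanning n.
  exists #|J|; apply/asboolP; exists (fun i => t (enum_val i)) => x.
  exists (fun i => f (enum_val i) x).
  rewrite {1}(tf.2 x) (reindex _ (onW_bij _ (enum_val_bij J))) subrr.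
  by rewrite -(scale0r 0); apply: ideal_spanZm; case: mL.
case: (ex_minnP ex_span) => d /asboolP[b span_b] min_d.
exists d, b; split=> // c rel_c i; apply: contrapT => ci.
case: d b span_b min_d c rel_c i ci => [|d] b span_b min_d c rel_c i ci.
  by case: i {ci}.
suff : (d.+1 <= d)%N by rewrite ltnn.
apply: min_d; apply/asboolP; exists (fun k => b (lift i k)).
exact: spans_fibre_shrink rel_c ci.
Qed.

(** The trace of the identity is computed in two ways. Writing the t j in terms
    of a basis b of the fibre turns f into coordinates e for b, which satisfy
    e_i(b_i) = 1 modulo m by linear independence; the sums of the e_i(b_i) and
    of the f_j(t_j) agree modulo m. *)
Lemma fibre_dim_trace d : fibre_dim m d -> m (\sum_j f j (t j) - d%:R).
Proof.
move=> [b [span_b indep_b]].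
have [c cP] := choice (fun j => span_b (t j)).
pose e i x := \sum_j f j x * c j i.
have eP x : ideal_span m (x - \sum_i e i x *: b i).
  have -> : x - \sum_i e i x *: b i
      = \sum_j f j x *: (t j - \sum_i c j i *: b i).
    have -> : \sum_i e i x *: b i = \sum_j f j x *: (\sum_i c j i *: b i).
      under eq_bigr => i _ do rewrite /e scaler_suml.
      rewrite exchange_big; apply: eq_bigr => j _; rewrite scaler_sumr.
      by apply: eq_bigr => i _; rewrite scalerA.
    by rewrite {1}(tf.2 x) -sumrB; apply: eq_bigr => j _; rewrite scalerBr.
  by apply: ideal_span_sum => j; apply: ideal_spanZ.
have e_diag i : m (e i (b i) - 1).
  have := indep_b (fun k => e k (b i) - (k == i)%:R) _ i; rewrite eqxx.
  apply; under eq_bigr => k _ do rewrite scalerBl.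
  have delta : \sum_k (k == i)%:R *: b k = b i.
    rewrite (bigD1 i) //= eqxx scale1r big1 ?addr0 // => k /negPf ->.
    exact: scale0r.
  by rewrite sumrB delta -opprB -scaleN1r; apply: ideal_spanZ.
have -> : \sum_j f j (t j) - d%:R =
    \sum_j f j (t j - \sum_i c j i *: b i) + \sum_i (e i (b i) - 1).
  have fE j : f j (t j - \sum_i c j i *: b i) =
      f j (t j) - \sum_i c j i * f j (b i).
    rewrite -scaleN1r (dual_basisD tf) (dual_basisZ tf) mulN1r.
    rewrite (dual_basis_sum tf); congr (_ - _).
    by apply: eq_bigr => i _; rewrite (dual_basisZ tf).
  rewrite (eq_bigr _ (fun j _ => fE j)) !sumrB sumr_const card_ord.
  have -> : \sum_j \sum_i c j i * f j (b i) = \sum_i e i (b i).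
    rewrite exchange_big; apply: eq_bigr => i _; apply: eq_bigr => j _.
    exact: mulrC.
  by rewrite addrA subrK.
have [_ mD _] := mL; apply: (mD).
  by apply: (left_ideal_sum _ mL) => j _; apply: (ideal_spanP _).1 (cP j) j.
exact: (left_ideal_sum _ mL).
Qed.

End FibreDimension.

(** The fibre dimension is congruent to n modulo m, and a difference of distinct
    natural numbers is a unit of the centre. *)
Lemma has_rank_trace (J : finType) (t : J -> M) (f : J -> M -> Z) n :
  dual_basis t f -> \sum_j f j (t j) = n%:R ->
  (forall i, (0 < i)%N -> exists z : Z, z * i%:R = 1) -> has_rank T n.
Proof.
move=> tf trace_n char0 m max_m; have mL := maximal_left_ideal max_m.
have [d dimd] := fibre_dim_exists tf max_m.
have mdiff : m (n%:R - d%:R).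
  by rewrite -trace_n; exact: (fibre_dim_trace tf max_m dimd).
suff -> : n = d by [].
have unit_m i : (0 < i)%N -> ~ m i%:R.
  move=> /char0[z zi] mi; case: max_m => _ m1 _; apply: m1.
  by rewrite -zi; case: mL => _ _; apply.
have [nd|dn|//] := ltngtP n d; exfalso.
  apply: (unit_m (d - n)%N); first by rewrite subn_gt0.
  rewrite natrB 1?ltnW // -opprB -mulN1r.
  by case: mL => _ _; apply.
by apply: (unit_m (n - d)%N); rewrite ?subn_gt0 // natrB // ltnW.
Qed.

End Azumaya.

(** * Inertia groups and Galois systems *)
Section Inertia.
Variables (G : finGroupType) (A : comNzRingType) (act : ring_action G A).
Local Notation T := (skew_ring act).

Definition trivial_inertia : Prop :=
  forall m : set A, maximal_ideal m ->
  forall g, (forall a, m (a - act g a)) -> g = 1%g.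

Definition galois_system (I : finType) (x y : I -> A) : Prop :=
  forall g, \sum_i x i * act g (y i) = (g == 1%g)%:R.

(** An element that acts trivially on A/m stabilises m. *)
Lemma trivial_inertia_of_free : acts_freely act -> trivial_inertia.
Proof.
move=> free m max_m g mg; apply: (free m max_m).
have mL := maximal_left_ideal max_m.
apply/seteqP; split=> [_ [a ma <-]|a ma].
  by rewrite -[act g a](subKr a); apply: left_idealB.
exists (act g^-1%g a); last exact: ractVK.
have := mg (act g^-1%g a); rewrite ractVK => mb; have [_ mD _] := mL.
by rewrite -[act _ a](subrK a); apply: mD.
Qed.

(** The elements a - g(a) lie in no common maximal ideal, so that
    1 = sum b_i (a_i - g(a_i)). The extra pair (- sum b_i g(a_i), 1) turns the
    pairs (b_i, a_i) into a system separating g from 1. *)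
Lemma separating_pairs g :
  noetherian A -> trivial_inertia -> g != 1%g ->
  exists s : seq (A * A), \sum_(p <- s) p.1 * p.2 = 1 /\
    \sum_(p <- s) p.1 * act g p.2 = 0.
Proof.
move=> noethA inertia g1.
pose J : set A :=
  [set a | exists s : seq (A * A), a = \sum_(p <- s) p.1 * (p.2 - act g p.2)].
have JL : left_ideal J.
  split=> [|_ _ [s ->] [s' ->]|r _ [s ->]].
  - by exists [::]; rewrite big_nil.
  - by exists (s ++ s'); rewrite big_cat.
  - exists [seq (r * p.1, p.2) | p <- s]; rewrite big_map mulr_sumr.
    by apply: eq_bigr => p _; rewrite mulrA.
have [s s1] : J 1.
  apply: contrapT => J1.
  have [m [max_m Jm]] := noetherian_maximal_ideal noethA JL J1.
  case/eqP: g1; apply: (inertia m max_m) => a; apply: Jm.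
  by exists [:: (1, a)]; rewrite big_seq1 mul1r.
exists ((- \sum_(p <- s) p.1 * act g p.2, 1) :: s); rewrite !big_cons /=.
rewrite rmorph1 !mulr1 addNr; split=> //.
rewrite s1 addrC -sumrB; apply: eq_bigr => p _; by rewrite mulrBr.
Qed.

(** The product of systems separating g_1, ..., g_n from 1 separates all of them
    from 1. *)
Lemma galois_system_exists :
  noetherian A -> trivial_inertia ->
  exists n (x y : 'I_n -> A), galois_system x y.
Proof.
move=> noethA inertia.
have [s [s1 s0]] : exists s : seq (A * A), \sum_(p <- s) p.1 * p.2 = 1 /\
    forall g, g \in enum (predC1 1%g : {pred G}) ->
      \sum_(p <- s) p.1 * act g p.2 = 0.
  have: all (predC1 1%g) (enum (predC1 1%g : {pred G})).
    by apply/allP => g; rewrite mem_enum.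
  elim: (enum _) => [_|g S IHS /= /andP[g1 /IHS[s [s1 s0]]]].
    by exists [:: (1, 1)]; rewrite big_seq1 mul1r.
  have [t [t1 t0]] := separating_pairs noethA inertia g1.
  pose st := [seq (p.1 * q.1, p.2 * q.2) | p <- s, q <- t].
  have stE (f : {rmorphism A -> A}) : \sum_(p <- st) p.1 * f p.2 =
      (\sum_(p <- s) p.1 * f p.2) * (\sum_(p <- t) p.1 * f p.2).
    rewrite big_allpairs_dep mulr_suml; apply: eq_bigr => p _.
    by rewrite mulr_sumr; apply: eq_bigr => q _; rewrite /= rmorphM mulrACA.
  exists st; split; first by have := stE idfun; rewrite /= s1 t1 mul1r.
  move=> h; rewrite inE stE => /predU1P[->|/s0 ->]; last by rewrite mul0r.
  by rewrite t0 mulr0.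
exists (size s), (fun i => (tnth (in_tuple s) i).1),
  (fun i => (tnth (in_tuple s) i).2) => g.
rewrite -(big_tnth _ _ s xpredT (fun p => p.1 * act g p.2)).
have [->|g1] := eqVneq g 1%g; last by rewrite s0 // mem_enum.
by rewrite -[RHS]s1; apply: eq_bigr => p _; rewrite ract1.
Qed.

End Inertia.

(** * Skew group rings with a Galois system are Azumaya *)
Section GaloisAzumaya.
Variables (G : finGroupType) (A : comNzRingType) (act : ring_action G A).
Local Notation T := (skew_ring act).
Local Notation Z := (centre T).
Local Notation M := (over_centre T).
Variables (I : finType) (x y : I -> A).
Hypothesis xy : galois_system act x y.

Definition trace (a : A) : A := \sum_g act g a.

Lemma act_trace h a : act h (trace a) = trace a.
Proof.
rewrite rmorph_sum [RHS](reindex_inj (mulgI h)) /=.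
by apply: eq_bigr => g _; rewrite ractM.
Qed.

Lemma trace_central a : skew_mono act (trace a) 1%g \in in_centre T.
Proof.
apply/in_centreP => r; apply/ffunP=> g; rewrite mono_mulE mul_monoE.
by rewrite !invg1 mulg1 mul1g ract1 act_trace mulrC.
Qed.

Definition centre_trace a : Z := Centre (trace_central a).

Lemma galois_system_sym g : \sum_i act g (x i) * y i = (g == 1%g)%:R.
Proof.
transitivity (act g (\sum_i x i * act g^-1%g (y i))).
  rewrite rmorph_sum; apply: eq_bigr => i _.
  by rewrite rmorphM /= ractVK.
by rewrite xy rmorph_nat eq_invg1.
Qed.

Lemma trace_expandl a : \sum_i x i * trace (y i * a) = a.
Proof.
under eq_bigr => i _ do rewrite mulr_sumr.
rewrite exchange_big (bigD1 1%g) //= [X in _ + X]big1 => [|g /negPf g1].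
  rewrite addr0; under eq_bigr => i _ do rewrite rmorphM mulrA.
  by rewrite -mulr_suml xy eqxx mul1r ract1.
under eq_bigr => i _ do rewrite rmorphM mulrA.
by rewrite -mulr_suml xy g1 mul0r.
Qed.

Lemma trace_expandr a : \sum_i trace (a * x i) * y i = a.
Proof.
under eq_bigr => i _ do rewrite mulr_suml.
rewrite exchange_big (bigD1 1%g) //= [X in _ + X]big1 => [|g /negPf g1].
  rewrite addr0; under eq_bigr => i _ do rewrite rmorphM -mulrA.
  by rewrite -mulr_sumr galois_system_sym eqxx mulr1 ract1.
under eq_bigr => i _ do rewrite rmorphM -mulrA.
by rewrite -mulr_sumr galois_system_sym g1 mulr0.
Qed.

Local Notation e a := (skew_mono act a 1%g).
Local Notation u g := (skew_mono act 1 g).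

Lemma mono1M a b : e a * e b = e (a * b).
Proof. by rewrite skew_monoM ract1 mulg1. Qed.

Lemma centre_trace_mono (a b : A) (r s : T) :
  r * e (trace a * b) * s = centre_val (centre_trace a) * (r * e b * s).
Proof.
by rewrite -mono1M !mulrA; have /in_centreP -> := trace_central a.
Qed.

(** The element sum_i x_i (x) y_i commutes with A: expanding a x_i on the x_j
    gives invariant coefficients tr(y_j a x_i), which pass through the tensor
    sign and reassemble the y_i into y_j a. The factors r, s, r', s' put this
    identity in an arbitrary context. *)
Lemma casimir_base (a : A) (r s r' s' : T) :
  \sum_i pure_tensor (r * e (a * x i) * s : M) (r' * e (y i) * s' : M) =
  \sum_i pure_tensor (r * e (x i) * s : M) (r' * e (y i * a) * s' : M).
Proof.
have left_expand i : r * e (a * x i) * s =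
    \sum_j (centre_trace (y j * a * x i) *: (r * e (x j) * s : M) : M).
  rewrite -{1}[a * x i]trace_expandl skew_mono_sum mulr_sumr mulr_suml.
  apply: eq_bigr => j _.
  by rewrite [x j * _]mulrC centre_trace_mono [y j * (a * _)]mulrA centre_scaleE.
under eq_bigr => i _ do rewrite left_expand pure_tensor_suml.
rewrite exchange_big; apply: eq_bigr => j _.
under eq_bigr => i _ do rewrite pure_tensorZ.
rewrite -pure_tensor_sumr; congr pure_tensor.
rewrite -[in RHS](trace_expandr (y j * a)) skew_mono_sum mulr_sumr mulr_suml.
by apply: eq_bigr => i _; rewrite centre_trace_mono centre_scaleE.
Qed.

(** For j = (l, h), the coordinate at x_l h is r |-> tr(y_l r_h). It is inner:
    sum_i x_i (r h^-1) y_i = r_h by the defining property of the Galois system,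
    and the trace of y_l r_h is the sum over g of its conjugates by g. This
    gives the factors p = g x_i y_l and q = h^-1 y_i g^-1 for the summation
    index (g, i). *)
Definition galois_left (j : I * G) (l : G * I) : T :=
  u l.1 * e (x l.2 * y j.1).
Definition galois_right (j : I * G) (l : G * I) : T :=
  u j.2^-1%g * e (y l.2) * u l.1^-1%g.
Definition galois_base (j : I * G) : T := skew_mono act (x j.1) j.2.
Definition galois_coord (j : I * G) (r : T) : Z := centre_trace (y j.1 * r j.2).

Lemma galois_coord_inner j (r : T) :
  centre_val (galois_coord j r) = \sum_l galois_left j l * r * galois_right j l.
Proof.
case: j => j h /=; rewrite /trace skew_mono_sum.
rewrite -(pair_big xpredT xpredT (fun g i =>
  galois_left (j, h) (g, i) * r * galois_right (j, h) (g, i))) /=.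
apply: eq_bigr => g _; rewrite /galois_left /galois_right /=.
have term i k : u g * e (x i * y j) * skew_mono act (r k) k
    * (u h^-1%g * e (y i) * u g^-1%g) =
    skew_mono act (act g (y j * r k * (x i * act (k * h^-1)%g (y i))))
      (g * (k * h^-1) * g^-1)%g.
  rewrite !skew_monoM ?mulg1 ?mul1r ?rmorph1 ?mulr1 ?mulg1.
  by rewrite !rmorphM -!ractM !mulgA; congr skew_mono; ring.
under eq_bigr => i _ do rewrite {1}[r]skew_sum mulr_sumr mulr_suml.
rewrite exchange_big (bigD1 h) //= [X in _ + X]big1 => [|k kh].
  rewrite addr0; under eq_bigr => i _ do rewrite term.
  rewrite -skew_mono_sum -rmorph_sum -mulr_sumr xy mulgV eqxx mulr1.
  by rewrite mulg1 mulgV.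
under eq_bigr => i _ do rewrite term.
rewrite -skew_mono_sum -rmorph_sum -mulr_sumr xy.
rewrite -eq_mulgV1 (negPf kh) mulr0 rmorph0.
by apply/ffunP=> ?; rewrite skew_monoE skew0; case: eqP.
Qed.

(** It suffices to treat a = c k. Moving t = x_l h past g^-1 c k puts a factor
    d in A next to y_i; [casimir_base] carries it to the left factor, where
    the sum over l vanishes unless g = k. The remaining sum over h is the trace
    of y_i, which is central, and sum_i x_i tr(y_i) = 1. *)
Lemma galois_tensor_expansion (a b : T) :
  \sum_j \sum_l pure_tensor (galois_left j l : M)
      (galois_right j l * (a * galois_base j * b) : M)
    = pure_tensor (a : M) (b : M).
Proof.
have mono_case c k : \sum_j \sum_l pure_tensor (galois_left j l : M)
      (galois_right j l * (skew_mono act c k * galois_base j * b) : M)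
    = pure_tensor (skew_mono act c k : M) (b : M).
  pose d (g : G) (j : I) := act g^-1%g c * act (g^-1 * k)%g (x j).
  have move_base j h g : \sum_i pure_tensor (galois_left (j, h) (g, i) : M)
      (galois_right (j, h) (g, i)
        * (skew_mono act c k * galois_base (j, h) * b) : M)
    = \sum_i pure_tensor (u g * e (x i) * e (d g j * y j) : M)
        (u h^-1%g * e (y i) * (u (g^-1 * k * h)%g * b) : M).
    transitivity (\sum_i pure_tensor (u g * e (x i) * e (y j) : M)
      (u h^-1%g * e (y i * d g j) * (u (g^-1 * k * h)%g * b) : M)).
      apply: eq_bigr => i _; rewrite /galois_left /galois_right /galois_base /=.
      congr pure_tensor; first by rewrite -mono1M mulrA.
      rewrite -mono1M !mulrA; congr (_ * _); rewrite -!mulrA; congr (_ * (_ * _)).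
      by rewrite !skew_monoM !mul1r !mul1g rmorph1 mulr1 rmorphM -ractM mulgA.

    rewrite -casimir_base; apply: eq_bigr => i _; congr pure_tensor.
    rewrite -!(mulrA (u g)) !mono1M; congr (_ * skew_mono act _ _); ring.
  rewrite -(pair_big xpredT xpredT (fun j h => \sum_l
    pure_tensor (galois_left (j, h) l : M)
     (galois_right (j, h) l * (skew_mono act c k * galois_base (j, h) * b) : M))).
  rewrite exchange_big /=.
  have sum_base h : \sum_j \sum_l pure_tensor (galois_left (j, h) l : M)
      (galois_right (j, h) l
        * (skew_mono act c k * galois_base (j, h) * b) : M)
    = \sum_i pure_tensor (u k * e (x i * act k^-1%g c) : M)
        (u h^-1%g * e (y i) * u h * b : M).
    under eq_bigr => j _.
      rewrite -(pair_big xpredT xpredT (fun g i =>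
        pure_tensor (galois_left (j, h) (g, i) : M)
         (galois_right (j, h) (g, i)
            * (skew_mono act c k * galois_base (j, h) * b) : M))) /=.
      under eq_bigr => g _ do rewrite move_base.
      over.
    rewrite exchange_big (bigD1 k) //= [X in _ + X]big1 => [|g gk].
      rewrite addr0 exchange_big; apply: eq_bigr => i _.
      rewrite -pure_tensor_suml mulVg mul1g mulrA; congr pure_tensor.
      rewrite -[LHS]mulr_sumr -mulrA; congr (_ * _).
      rewrite -skew_mono_sum mono1M; congr skew_mono; congr (_ * _).
      under eq_bigr => j _ do rewrite /d mulVg -mulrA.
      by rewrite -mulr_sumr galois_system_sym eqxx mulr1.
    rewrite exchange_big big1 // => i _.
    rewrite -pure_tensor_suml -[\sum_j _]mulr_sumr -skew_mono_sum.
    under eq_bigr => j _ do rewrite /d -mulrA.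
    rewrite -mulr_sumr galois_system_sym -eq_mulVg1 (negPf gk) mulr0.
    by rewrite skew_mono0 mulr0 pure_tensor0l.
  under eq_bigr => h _ do rewrite sum_base.
  rewrite exchange_big /=.
  transitivity (\sum_i pure_tensor (u k * e (x i * act k^-1%g c) : M)
      (centre_trace (y i) *: (b : M))).
    apply: eq_bigr => i _; rewrite -pure_tensor_sumr; congr pure_tensor.
    rewrite centre_scaleE -[LHS]mulr_suml; congr (_ * _).
    rewrite /= /trace skew_mono_sum (reindex_inj invg_inj); apply: eq_bigr => h _.
    by rewrite !skew_monoM invgK mul1r rmorph1 mulr1 mulg1 mulgV.
  under eq_bigr => i _ do rewrite -pure_tensorZ.
  rewrite -pure_tensor_suml; congr pure_tensor.
  under eq_bigr => i _ do rewrite centre_scaleE.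
  transitivity (u k * e (\sum_i x i * trace (y i) * act k^-1%g c)).
    rewrite skew_mono_sum mulr_sumr; apply: eq_bigr => i _.
    have /in_centreP -> := trace_central (y i).
    by rewrite -[LHS]mulrA mono1M mulrAC.
  have := trace_expandl 1; under eq_bigr => i _ do rewrite mulr1.
  rewrite -mulr_suml => ->.
  by rewrite mul1r skew_monoM mul1r mulg1 ractVK.
rewrite {2}[a]skew_sum pure_tensor_suml.
under [RHS]eq_bigr => k _ do rewrite -mono_case.
rewrite [RHS]exchange_big; apply: eq_bigr => j _.
rewrite [RHS]exchange_big; apply: eq_bigr => l _.
rewrite -pure_tensor_sumr; congr pure_tensor.
by rewrite -[RHS]mulr_sumr -!mulr_suml -skew_sum.
Qed.

Lemma galois_azumaya : azumaya T.
Proof. exact: azumaya_criterion galois_coord_inner galois_tensor_expansion. Qed.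

Lemma galois_dual_basis : @dual_basis Z M _ galois_base galois_coord.
Proof.
exact: criterion_dual_basis galois_coord_inner galois_tensor_expansion.
Qed.

(** The trace is the sum over l and h of tr(y_l x_l), hence |G| tr(1). *)
Lemma galois_coord_trace :
  \sum_j galois_coord j (galois_base j) = (#|G| ^ 2)%:R.
Proof.
apply: val_inj; rewrite rmorph_sum rmorph_nat /=.
rewrite -skew_mono_sum -skew_mono_nat; congr skew_mono.
have trace_sum : \sum_i trace (y i * x i) = #|G|%:R.
  rewrite exchange_big /= -sumr_const; apply: eq_bigr => g _.
  rewrite -rmorph_sum -[RHS](rmorph1 (act g)); congr (act g _).
  transitivity (\sum_i x i * act 1%g (y i)); last by rewrite xy eqxx.
  apply: eq_bigr => i _.
  by rewrite ract1 mulrC.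
under eq_bigr => j _ do rewrite skew_monoE eqxx.
rewrite -(pair_big xpredT xpredT (fun i (h : G) => trace (y i * x i))) /=.
under eq_bigr => i _ do rewrite sumr_const.
by rewrite sumrMnl trace_sum -mulrnA mulnn.
Qed.

End GaloisAzumaya.

(** * Azumaya skew group rings have trivial inertia groups *)
Section AzumayaInertia.
Variables (G : finGroupType) (A : comNzRingType) (act : ring_action G A).
Local Notation T := (skew_ring act).
Hypothesis domain_A : GRing.integral_domain_axiom A.
Hypothesis act_faithful : faithful_action act.
Variable m : set A.
Hypothesis max_m : maximal_ideal m.

Let mL : left_ideal m := maximal_left_ideal max_m.
Let mD x y : m x -> m y -> m (x + y). Proof. by case: mL => _ + _; apply. Qed.
Let mM a x : m x -> m (a * x). Proof. by case: mL => _ _; apply. Qed.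
Let mB x y : m x -> m y -> m (x - y). Proof. exact: left_idealB. Qed.

Definition inertia (h : G) : bool := `[< forall a, m (a - act h a) >].
Definition stabilises (l : G) : Prop := forall a, m a -> m (act l a).

Lemma inertiaP h : reflect (forall a, m (a - act h a)) (inertia h).
Proof. exact: asboolP. Qed.

Lemma inertia_stabilises h : inertia h -> stabilises h.
Proof. by move=> /inertiaP hm a ma; rewrite -[act h a](subKr a); apply: mB. Qed.

Lemma inertia1 : inertia 1%g.
Proof. by apply/inertiaP => a; rewrite ract1 subrr; case: mL. Qed.

Lemma inertiaM h h' : inertia h -> inertia h' -> inertia (h * h')%g.
Proof.
move=> hI /inertiaP h'm; apply/inertiaP => a.
have /inertiaP hm := hI; have hS := inertia_stabilises hI.
have -> : a - act (h * h')%g a = (a - act h a) + act h (a - act h' a).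
  by rewrite rmorphB ractM addrA subrK.
by apply: mD => //; apply: hS.
Qed.

Lemma inertiaV h : inertia h -> inertia h^-1%g.
Proof.
move=> /inertiaP hm; apply/inertiaP => a.
have := hm (act h^-1%g a); rewrite ractVK => ma.
by rewrite -opprB -mulN1r; apply: mM.
Qed.

Lemma inertia_mulr h h' : inertia h -> inertia (h * h')%g = inertia h'.
Proof.
move=> hI; apply/idP/idP => [|h'I]; last exact: inertiaM.
by move/(inertiaM (inertiaV hI)); rewrite mulKg.
Qed.

Lemma stabilisesV l : stabilises l -> stabilises l^-1%g.
Proof.
move=> lS; rewrite invg_expg; elim: (#[l]%g.-1) => [|n IHn] a ma.
  by rewrite ract1.
by rewrite expgS ractM; apply/lS/IHn.
Qed.

Lemma inertia_normal h l :
  stabilises l -> inertia h -> inertia (l^-1 * h * l)%g.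
Proof.
move=> lS /inertiaP hm; apply/inertiaP => a.
have -> : a - act (l^-1 * h * l)%g a =
    act l^-1%g (act l a - act h (act l a)).
  by rewrite rmorphB ractK -!ractM mulgA.
exact: stabilisesV.
Qed.

(** The annihilator of the module induced to A # G from the module A/m over
    A # H, where H is the inertia group: the module has a basis indexed by the
    cosets g H, and r maps g^-1 H to the sum over the cosets l H of l H times
    the class in A/m of l^-1 (sum_h r_{lhg}). *)
Definition inertia_ideal : set T :=
  [set r | forall l g : G,
     m (act l^-1%g (\sum_(h | inertia h) r (l * h * g)%g))].

Lemma inertia_ideal_two_sided : two_sided_ideal inertia_ideal.
Proof.
have J0 : inertia_ideal 0.
  by move=> l g; rewrite big1 => [|h _]; rewrite ?skew0 // rmorph0; case: mL.
have JD r s : inertia_ideal r -> inertia_ideal s -> inertia_ideal (r + s).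
  move=> Jr Js l g; under eq_bigr => h _ do rewrite skewD.
  by rewrite big_split rmorphD; apply: mD.
have Jsum (F : G -> T) : (forall g, inertia_ideal (F g)) ->
    inertia_ideal (\sum_g F g).
  by move=> JF; elim/big_rec: _ => // g r _; apply: JD.
split; split=> // s r Jr.
  rewrite [s]skew_sum mulr_suml; apply: Jsum => k l g.
  under eq_bigr => h _ do rewrite mono_mulE !mulgA.
  rewrite -mulr_sumr -rmorph_sum rmorphM /= -ractM; apply: mM.
  by have := Jr (k^-1 * l)%g g; rewrite invMg invgK.
rewrite [s]skew_sum mulr_sumr; apply: Jsum => k l g.
rewrite rmorph_sum /=.
(* H acts trivially modulo m, so that act h can be dropped in each term up to
   an element of m. *)
have -> : \sum_(h | inertia h)
      act l^-1%g ((r * skew_mono act (s k) k) (l * h * g)%g)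
  = act (g * k^-1)%g (s k)
      * act l^-1%g (\sum_(h | inertia h) r (l * h * (g * k^-1))%g)
    - \sum_(h | inertia h) act l^-1%g (r (l * h * (g * k^-1))%g)
      * (act (g * k^-1)%g (s k) - act h (act (g * k^-1)%g (s k))).
  rewrite rmorph_sum mulr_sumr -sumrB; apply: eq_bigr => h _.
  rewrite mul_monoE !mulgA rmorphM /= -!ractM !mulgA mulVg mul1g.
  ring.
apply: mB; first by apply/mM/Jr.
by apply: (left_ideal_sum _ mL) => h /inertiaP hm; apply: mM.
Qed.

(** For l outside the stabiliser, l m is not contained in m, and a product of
    elements of the sets l m outside m is outside m because m is prime. *)
Lemma outside_stabiliser :
  exists e : A, ~ m e /\ forall l, ~ stabilises l -> m (act l^-1%g e).
Proof.
have move_out l : exists b : A,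
    ~ stabilises l -> m (act l^-1%g b) /\ ~ m b.
  have [lS|lnS] := pselect (stabilises l); first by exists 0.
  have [a [ma la]] : exists a, m a /\ ~ m (act l a).
    apply: contrapT => no_a; apply: lnS => a ma; apply: contrapT => la.
    by apply: no_a; exists a.
  by exists (act l a) => _; rewrite ractK.
have [b bP] := choice move_out.
exists (\prod_(l | `[< ~ stabilises l >]) b l); split.
  by apply: maximal_prod => // l /asboolP/bP[].
move=> l lnS; rewrite (bigD1 l) /=; last exact/asboolP.
by rewrite rmorphM mulrC; apply/mM/(bP l lnS).1.
Qed.

(** The ideal contains e (h0 - 1): for l outside the stabiliser the coefficients
    lie in l m, and for l inside it the two terms cancel since l normalises H.
    Its central elements lie in m, since they are supported at 1. So the
    coefficient -e at 1 would lie in m. *)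
Lemma azumaya_inertia h0 : azumaya T -> inertia h0 -> h0 = 1%g.
Proof.
move=> azuT h0I; apply: contrapT => /eqP h0n1.
have [e [me eP]] := outside_stabiliser; apply: me.
pose r : T := skew_mono act e h0 - skew_mono act e 1%g.
have Jr : inertia_ideal r.
  move=> l g; under eq_bigr => h _ do rewrite skewB !skew_monoE.
  have [lS|lnS] := pselect (stabilises l).
    (* The translation by l^-1 h0 l, which lies in H, matches the terms h0 of
       the first sum with the terms 1 of the second. *)
    rewrite sumrB (reindex_inj (mulgI (l^-1 * h0 * l)%g)) /=.
    rewrite (eq_bigl inertia) => [|h]; last first.
      exact/inertia_mulr/inertia_normal.
    under eq_bigr => h _ do
      rewrite !mulgA mulgV mul1g -!mulgA -{2}[h0]mulg1 (inj_eq (mulgI h0)) !mulgA.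
    by rewrite subrr rmorph0; case: mL.
  rewrite rmorph_sum; apply: (left_ideal_sum _ mL) => h _.
  have m0 : m 0 by case: mL.
  by rewrite rmorphB; apply: mB; case: ifP => _; rewrite ?rmorph0 //; apply: eP.
have [n [c [t [Jc rE]]]] := azumaya_ideal_central azuT inertia_ideal_two_sided Jr.
have mc i : m ((centre_val (c i) : T) 1%g).
  have := Jc i 1%g 1%g; rewrite invg1 ract1 (bigD1 1%g) ?inertia1 //=.
  rewrite big1 ?addr0 ?mulg1 // => h /andP[_ h1].
  by rewrite centre_support // mulg1 mul1g.
have : m (r 1%g).
  rewrite rE skew_sumE; apply: (left_ideal_sum _ mL) => i _.
  rewrite centre_scaleE skew_mulE (bigD1 1%g) //= big1 => [|g g1].
    by rewrite addr0 mulrC; apply: mM.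
  by rewrite centre_support // mul0r.
rewrite skewB !skew_monoE eqxx eq_sym (negPf h0n1) sub0r => me.
by rewrite -[e]opprK -mulN1r; apply: mM.
Qed.

End AzumayaInertia.

Lemma azumaya_trivial_inertia (G : finGroupType) (A : comNzRingType)
    (act : ring_action G A) :
  GRing.integral_domain_axiom A -> faithful_action act ->
  azumaya (skew_ring act) -> trivial_inertia act.
Proof.
move=> domain_A act_faithful azuT m max_m g /inertiaP.
exact: azumaya_inertia.
Qed.

(** * Linear actions on algebras over a field *)
Section AlgebraAction.
Variables (k : fieldType) (A : comAlgType k) (G : finGroupType).
Variable act : ring_action G A.
Hypothesis act_scale : forall g (c : k) (a : A), act g (c *: a) = c *: act g a.
Local Notation T := (skew_ring act).

Lemma act_scalar g (c : k) : act g c%:A = c%:A.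
Proof. by rewrite act_scale rmorph1. Qed.

Lemma free_of_trivial_inertia :
  rational_residue_fields A -> trivial_inertia act -> acts_freely act.
Proof.
move=> rational inertia m max_m g gm; apply: (inertia m max_m) => a.
have [c mc] := rational m max_m a.
have mgc : m (act g a - c%:A).
  by rewrite -gm; exists (a - c%:A) => //; rewrite rmorphB act_scalar.
have -> : a - act g a = (a - c%:A) - (act g a - c%:A).
  by rewrite opprB addrA subrK.
exact: left_idealB (maximal_left_ideal max_m) _ _.
Qed.

Lemma centre_nat_unit n :
  [pchar k] =i pred0 -> (0 < n)%N -> exists z : centre T, z * n%:R = 1.
Proof.
move=> char_k n_gt0; pose a : A := (n%:R^-1 : k)%:A.
have az : skew_mono act a 1%g \in in_centre T.
  apply/in_centreP => r; apply/ffunP=> g; rewrite mono_mulE mul_monoE.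
  by rewrite !invg1 mulg1 mul1g ract1 act_scalar mulrC.
exists (Centre az); apply: val_inj; rewrite rmorphM rmorph_nat /=.
rewrite -skew_mono_nat skew_monoM ract1 mulg1.
suff -> : a * n%:R = 1 by [].
rewrite mulr_natr -scaler_nat scalerA mulfV ?scale1r //.
by have /pcharf0P -> := char_k; rewrite -lt0n.
Qed.

End AlgebraAction.

Theorem corollary1p2
  (k : closedFieldType) (char_k : [pchar k] =i pred0)
  (A : comAlgType k) (noeth_A : noetherian A)
  (domain_A : GRing.integral_domain_axiom A)
  (G : finGroupType) (act : ring_action G A)
  (act_scale : forall g (c : k) (a : A), act g (c *: a) = c *: act g a)
  (act_faithful : faithful_action act) :
  let T := skew_ring act in
  [/\ prime_ring T,
      noetherian T,
      acts_freely act -> azumaya T,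
      rational_residue_fields A -> (azumaya T <-> acts_freely act)
    & azumaya T -> has_rank T (#|G| ^ 2)].
Proof.
move=> T.
have free_azumaya : acts_freely act -> azumaya T.
  move=> /trivial_inertia_of_free/(galois_system_exists noeth_A)[n [x [y xy]]].
  exact: galois_azumaya xy.
have azumaya_inertia : azumaya T -> trivial_inertia act.
  exact: azumaya_trivial_inertia.
split=> //.
- exact: skew_prime.
- exact: skew_noetherian.
- move=> rational; split=> // /azumaya_inertia.
  exact: free_of_trivial_inertia.
- move=> /azumaya_inertia/(galois_system_exists noeth_A)[n [x [y xy]]].
  apply: has_rank_trace (galois_dual_basis xy) (galois_coord_trace xy) _ => i.
  exact: centre_nat_unit.
Qed.
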